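(* Let $\varphi\colon R\to S$ be a flat homomorphism of commutative rings. (1) If $F_\bullet$ is an $\mathbf{F}$-totally acyclic complex of flat $R$-modules, then $S\otimes_R F_\bullet$ is an $\mathbf{F}$-totally acyclic complex of flat $S$-modules. (2) If $\varphi$ is faithfully flat and $F_\bullet$ is a complex of $R$-modules such that $S\otimes_R F_\bullet$ is an $\mathbf{F}$-totally acyclic complex of flat $S$-modules, then $F_\bullet$ is an $\mathbf{F}$-totally acyclic complex of flat $R$-modules.
   Context: For a commutative ring $R$, a ($\mathbb{Z}$-indexed, possibly unbounded) complex $F_\bullet=\cdots\to F_{i+1}\to F_i\to F_{i-1}\to\cdots$ of flat $R$-modules is called $\mathbf{F}$-totally acyclic if it is acyclic and $I\otimes_R F_\bullet$ is acyclic for every injective $R$-module $I$. *)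

(* Defs.v *)
From HB Require Import structures.
From mathcomp Require Import all_boot all_algebra generic_quotient boolp.

Set Implicit Arguments.
Unset Strict Implicit.
Unset Printing Implicit Defensive.

Import GRing.Theory.
Local Open Scope ring_scope.
Local Open Scope quotient_scope.

(* Commutative rings are taken in comPzRingType, so the zero ring is allowed. *)

(* A list [:: (m1, n1); ...; (mk, nk)] stands for m1 (x) n1 + ... + mk (x) nk.
   The list monoid is used in place of the free abelian group on M * N, because
   - (m (x) n) = (- m) (x) n; this is why tensor_zero has to be imposed.
   The universal property is tensor_lift_pure and tensor_ext below. *)
Inductive tensor_eq (R : comPzRingType) (M N : lmodType R) :
    seq (M * N) -> seq (M * N) -> Prop :=
  | tensor_refl s : tensor_eq s s
  | tensor_sym s t : tensor_eq s t -> tensor_eq t s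
  | tensor_trans s t u : tensor_eq s t -> tensor_eq t u -> tensor_eq s u
  | tensor_cat s s' t t' :
      tensor_eq s s' -> tensor_eq t t' -> tensor_eq (s ++ t) (s' ++ t')
  | tensor_comm s t : tensor_eq (s ++ t) (t ++ s)
  | tensor_addl m m' n : tensor_eq [:: (m + m', n)] [:: (m, n); (m', n)]
  | tensor_addr m n n' : tensor_eq [:: (m, n + n')] [:: (m, n); (m, n')]
  | tensor_mid (a : R) m n : tensor_eq [:: (a *: m, n)] [:: (m, a *: n)]
  | tensor_zero n : tensor_eq [:: (0, n)] [::].

Section Tensor.
Variables (R : comPzRingType) (M N : lmodType R).
Implicit Types (s t : seq (M * N)) (m : M) (n : N) (a : R).

Definition tensor_rel s t : bool := `[< tensor_eq s t >].

Lemma tensor_rel_equiv : equiv_class_of tensor_rel.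
Proof.
split.
- by move=> s; apply/asboolP; exact: tensor_refl.
- by move=> s t; apply/asboolP/asboolP; exact: tensor_sym.
- move=> t s u /asboolP st /asboolP tu; apply/asboolP.
  exact: tensor_trans st tu.
Qed.

Definition tensor_equiv := EquivRelPack tensor_rel_equiv.

Definition tensor : Type := {eq_quot tensor_equiv}.

HB.instance Definition _ := Choice.copy tensor {eq_quot tensor_equiv}.

Definition tensor_pi s : tensor := \pi_({eq_quot tensor_equiv}) s.
Definition tensor_repr (x : tensor) : seq (M * N) :=
  repr (x : {eq_quot tensor_equiv}).

Lemma tensor_reprK x : tensor_pi (tensor_repr x) = x.
Proof. exact: reprK. Qed.

Lemma tensor_piP s t : tensor_pi s = tensor_pi t <-> tensor_eq s t.
Proof.
split=> [/eqP|st]; first by rewrite piE => /asboolP.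
by apply/eqP; rewrite piE; apply/asboolP.
Qed.

Lemma tensor_reprP s : tensor_eq (tensor_repr (tensor_pi s)) s.
Proof. by apply/tensor_piP; rewrite tensor_reprK. Qed.

Definition tensor_zero_elt : tensor := tensor_pi [::].
Definition tensor_add (x y : tensor) : tensor :=
  tensor_pi (tensor_repr x ++ tensor_repr y).

Lemma tensor_addE s t :
  tensor_add (tensor_pi s) (tensor_pi t) = tensor_pi (s ++ t).
Proof. by apply/tensor_piP; apply: tensor_cat; exact: tensor_reprP. Qed.

Lemma tensor_addA : associative tensor_add.
Proof.
move=> x y z; rewrite -[x]tensor_reprK -[y]tensor_reprK -[z]tensor_reprK.
by rewrite !tensor_addE catA.
Qed.

Lemma tensor_addC : commutative tensor_add.
Proof. by move=> x y; apply/tensor_piP; exact: tensor_comm. Qed.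

Lemma tensor_add0 : left_id tensor_zero_elt tensor_add.
Proof. by move=> x; rewrite -[x]tensor_reprK tensor_addE. Qed.

HB.instance Definition _ :=
  GRing.isNmodule.Build tensor tensor_addA tensor_addC tensor_add0.

Definition pure m n : tensor := tensor_pi [:: (m, n)].

Lemma tensor_piE s : tensor_pi s = \sum_(p <- s) pure p.1 p.2.
Proof.
elim: s => [|[m n] s IH]; first by rewrite big_nil.
by rewrite big_cons -IH -[RHS]/(tensor_add _ _) tensor_addE.
Qed.

Lemma pureDl m m' n : pure (m + m') n = pure m n + pure m' n.
Proof.
by rewrite -[RHS]/(tensor_add _ _) tensor_addE; apply/tensor_piP/tensor_addl.
Qed.

Lemma pureDr m n n' : pure m (n + n') = pure m n + pure m n'.
Proof.
by rewrite -[RHS]/(tensor_add _ _) tensor_addE; apply/tensor_piP/tensor_addr.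
Qed.

Lemma pure0l n : pure 0 n = 0.
Proof. by apply/tensor_piP/tensor_zero. Qed.

Lemma pureZ a m n : pure (a *: m) n = pure m (a *: n).
Proof. by apply/tensor_piP/tensor_mid. Qed.

Definition tensor_opp (x : tensor) : tensor :=
  \sum_(p <- tensor_repr x) pure (- p.1) p.2.

Lemma tensor_addN : left_inverse 0 tensor_opp +%R.
Proof.
move=> x; rewrite -{2}[x]tensor_reprK tensor_piE -big_split big1 //= => p _.
by rewrite -pureDl addNr pure0l.
Qed.

HB.instance Definition _ := GRing.Nmodule_isZmodule.Build tensor tensor_addN.

Definition balanced (V : zmodType) (h : M -> N -> V) : Prop :=
  [/\ forall m m' n, h (m + m') n = h m n + h m' n,
      forall m n n', h m (n + n') = h m n + h m n' &
      forall a m n, h (a *: m) n = h m (a *: n)].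

Lemma pure_balanced : balanced pure.
Proof. by split; [exact: pureDl|exact: pureDr|exact: pureZ]. Qed.

(* Meaningful only if h is balanced. *)
Definition tensor_lift (V : zmodType) (h : M -> N -> V) (x : tensor) : V :=
  \sum_(p <- tensor_repr x) h p.1 p.2.

Section Lift.
Variables (V : zmodType) (h : M -> N -> V).
Hypothesis hB : balanced h.

Lemma tensor_lift_pi s : tensor_lift h (tensor_pi s) = \sum_(p <- s) h p.1 p.2.
Proof.
have [hDl hDr hZ] := hB; rewrite /tensor_lift.
move: (tensor_repr _) (tensor_reprP s) => t0; elim=> {t0 s} //=.
- by move=> s t u _ -> _ ->.
- by move=> s s' t t' _ es _ et; rewrite !big_cat es et.
- by move=> s t; rewrite !big_cat /= addrC.
- by move=> m m' n; rewrite !big_cons !big_nil !addr0 hDl.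
- by move=> m n n'; rewrite !big_cons !big_nil !addr0 hDr.
- by move=> a m n; rewrite !big_seq1 hZ.
- move=> n; rewrite big_seq1 big_nil /=; apply: (addrI (h 0 n)).
  by rewrite -hDl !addr0.
Qed.

Lemma tensor_lift_pure m n : tensor_lift h (pure m n) = h m n.
Proof. by rewrite tensor_lift_pi big_seq1. Qed.

Lemma tensor_liftD x y :
  tensor_lift h (x + y) = tensor_lift h x + tensor_lift h y.
Proof.
rewrite -[x]tensor_reprK -[y]tensor_reprK.
rewrite -[X in tensor_lift h X]/(tensor_add _ _).
by rewrite tensor_addE !tensor_lift_pi big_cat.
Qed.

End Lift.

Lemma tensor_ext (V : nmodType) (f g : tensor -> V) :
    f 0 = 0 -> g 0 = 0 ->
    (forall x y, f (x + y) = f x + f y) ->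
    (forall x y, g (x + y) = g x + g y) ->
    (forall m n, f (pure m n) = g (pure m n)) ->
  f =1 g.
Proof.
move=> f0 g0 fD gD fg x; rewrite -[x]tensor_reprK tensor_piE.
elim: (tensor_repr x) => [|p s IH]; first by rewrite !big_nil f0 g0.
by rewrite !big_cons fD gD fg IH.
Qed.

Lemma tensor_ind_pure (P : tensor -> Prop) :
    P 0 -> (forall x y, P x -> P y -> P (x + y)) ->
    (forall m n, P (pure m n)) ->
  forall x, P x.
Proof.
move=> P0 PD Pp x; rewrite -[x]tensor_reprK tensor_piE.
by elim/big_ind: _.
Qed.

End Tensor.

Section TensorMap.
Variables (R : comPzRingType) (M M' N N' : lmodType R).

Definition tensor_map (f : {linear M -> M'}) (g : {linear N -> N'}) :
    tensor M N -> tensor M' N' :=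
  tensor_lift (fun m n => pure (f m) (g n)).

Variables (f : {linear M -> M'}) (g : {linear N -> N'}).

Lemma tensor_map_balanced : balanced (fun m n => pure (f m) (g n)).
Proof.
split=> [m m' n|m n n'|a m n].
- by rewrite linearD pureDl.
- by rewrite linearD pureDr.
- by rewrite !linearZ pureZ.
Qed.

Lemma tensor_map_pure m n : tensor_map f g (pure m n) = pure (f m) (g n).
Proof. exact: tensor_lift_pure tensor_map_balanced _ _. Qed.

Lemma tensor_mapD x y :
  tensor_map f g (x + y) = tensor_map f g x + tensor_map f g y.
Proof. exact: tensor_liftD tensor_map_balanced _ _. Qed.

Lemma tensor_map0 : tensor_map f g 0 = 0.
Proof. by apply: (addrI (tensor_map f g 0)); rewrite -tensor_mapD !addr0. Qed.

End TensorMap.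


Section TensorModule.
Variables (R : comPzRingType) (M N : lmodType R).

Definition tensor_scale (a : R) : tensor M N -> tensor M N :=
  tensor_map ( *:%R a : {linear M -> M}) (idfun : {linear N -> N}).

Lemma tensor_scale_pure a m n : tensor_scale a (pure m n) = pure (a *: m) n.
Proof. exact: tensor_map_pure. Qed.

Lemma tensor_scaleA a b x :
  tensor_scale a (tensor_scale b x) = tensor_scale (a * b) x.
Proof.
elim/tensor_ind_pure: x => [|x y IHx IHy|m n].
- by rewrite /tensor_scale !tensor_map0.
- by rewrite /tensor_scale !tensor_mapD -!/(tensor_scale _ _) IHx IHy.
- by rewrite !tensor_scale_pure scalerA.
Qed.

Lemma tensor_scale1 : left_id 1 tensor_scale.
Proof.
elim/tensor_ind_pure => [|x y IHx IHy|m n].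
- by rewrite /tensor_scale !tensor_map0.
- by rewrite /tensor_scale !tensor_mapD -!/(tensor_scale _ _) IHx IHy.
- by rewrite !tensor_scale_pure scale1r.
Qed.

Lemma tensor_scaleDr : right_distributive tensor_scale +%R.
Proof. by move=> a x y; rewrite /tensor_scale tensor_mapD. Qed.

Lemma tensor_scaleDl x : {morph tensor_scale^~ x : a b / a + b}.
Proof.
move=> a b; elim/tensor_ind_pure: x => [|x y IHx IHy|m n].
- by rewrite /tensor_scale !tensor_map0 addr0.
- by rewrite !tensor_scaleDr IHx IHy addrACA.
- by rewrite !tensor_scale_pure scalerDl pureDl.
Qed.

HB.instance Definition _ := GRing.Zmodule_isLmodule.Build R (tensor M N)
  tensor_scaleA tensor_scale1 tensor_scaleDr tensor_scaleDl.

Lemma pureZl (a : R) (m : M) (n : N) : pure (a *: m) n = a *: pure m n.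
Proof. by rewrite -[RHS]/(tensor_scale _ _) tensor_scale_pure. Qed.

Lemma pureZr (a : R) (m : M) (n : N) : pure m (a *: n) = a *: pure m n.
Proof. by rewrite -pureZ pureZl. Qed.

End TensorModule.

Section TensorMapLinear.
Variables (R : comPzRingType) (M M' N N' : lmodType R).
Variables (f : {linear M -> M'}) (g : {linear N -> N'}).

Lemma tensor_map_linear : linear (tensor_map f g).
Proof.
move=> a x y; rewrite tensor_mapD; congr (_ + _).
elim/tensor_ind_pure: x => [|x z IHx IHz|m n].
- by rewrite scaler0 tensor_map0 scaler0.
- by rewrite scalerDr !tensor_mapD IHx IHz scalerDr.
- by rewrite -pureZl !tensor_map_pure linearZ pureZl.
Qed.

HB.instance Definition _ :=
  GRing.isLinear.Build R (tensor M N) (tensor M' N') _ (tensor_map f g)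
    tensor_map_linear.

End TensorMapLinear.

(* The S-module M regarded as an R-module through phi. *)
Definition restrict (R S : comPzRingType) (phi : {rmorphism R -> S})
  (M : lmodType S) : Type := M.

Section Restrict.
Variables (R S : comPzRingType) (phi : {rmorphism R -> S}) (M : lmodType S).

HB.instance Definition _ := GRing.Zmodule.copy (restrict phi M) M.

Definition restrict_scale (a : R) (x : restrict phi M) : restrict phi M :=
  phi a *: (x : M).

Lemma restrict_scaleA a b x :
  restrict_scale a (restrict_scale b x) = restrict_scale (a * b) x.
Proof. by rewrite /restrict_scale scalerA rmorphM. Qed.

Lemma restrict_scale1 : left_id 1 restrict_scale.
Proof. by move=> x; rewrite /restrict_scale rmorph1 scale1r. Qed.

Lemma restrict_scaleDr : right_distributive restrict_scale +%R.
Proof. by move=> a x y; exact: scalerDr. Qed.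

Lemma restrict_scaleDl x : {morph restrict_scale^~ x : a b / a + b}.
Proof. by move=> a b; rewrite /restrict_scale rmorphD scalerDl. Qed.

HB.instance Definition _ := GRing.Zmodule_isLmodule.Build R (restrict phi M)
  restrict_scaleA restrict_scale1 restrict_scaleDr restrict_scaleDl.

Definition restrict_mul (s : S) (x : restrict phi M) : restrict phi M :=
  s *: (x : M).

Lemma restrict_mul_linear s : linear (restrict_mul s).
Proof.
move=> a x y; apply: etrans (scalerDr s (phi a *: (x : M)) (y : M)) _.
by congr (_ + _); apply: etrans (scalerA _ _ _) _; rewrite mulrC -scalerA.
Qed.

HB.instance Definition _ s :=
  GRing.isLinear.Build R (restrict phi M) (restrict phi M) _ (restrict_mul s)
    (restrict_mul_linear s).

End Restrict.

(* S (x)_R N; S acts on the left factor. *)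
Definition base_change (R S : comPzRingType) (phi : {rmorphism R -> S})
  (N : lmodType R) : Type := tensor (restrict phi S^o) N.

Section BaseChange.
Variables (R S : comPzRingType) (phi : {rmorphism R -> S}) (N : lmodType R).
Local Notation SN := (tensor (restrict phi S^o) N).

HB.instance Definition _ := GRing.Zmodule.copy (base_change phi N) SN.

Definition base_change_scale (s : S) (x : base_change phi N) :
    base_change phi N :=
  tensor_map (restrict_mul s : {linear restrict phi S^o -> restrict phi S^o})
    (idfun : {linear N -> N}) (x : SN).

Lemma base_change_scale_pure s t n :
  base_change_scale s (pure (t : restrict phi S^o) n) =
  pure (s * t : restrict phi S^o) n.
Proof. exact: tensor_map_pure. Qed.

Lemma base_change_scaleDr : right_distributive base_change_scale +%R.
Proof. by move=> s x y; exact: tensor_mapD. Qed.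

Lemma base_change_scale0 s : base_change_scale s 0 = 0.
Proof. exact: tensor_map0. Qed.

Lemma base_change_scaleA s t x :
  base_change_scale s (base_change_scale t x) = base_change_scale (s * t) x.
Proof.
elim/tensor_ind_pure: x => [|x y IHx IHy|u n].
- by rewrite !base_change_scale0.
- by rewrite !base_change_scaleDr IHx IHy.
- by rewrite !base_change_scale_pure mulrA.
Qed.

Lemma base_change_scale1 : left_id 1 base_change_scale.
Proof.
elim/tensor_ind_pure => [|x y IHx IHy|u n].
- by rewrite !base_change_scale0.
- by rewrite !base_change_scaleDr IHx IHy.
- by rewrite !base_change_scale_pure mul1r.
Qed.

Lemma base_change_scaleDl x : {morph base_change_scale^~ x : s t / s + t}.
Proof.
move=> s t; elim/tensor_ind_pure: x => [|x y IHx IHy|u n].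
- by rewrite !base_change_scale0 addr0.
- by rewrite !base_change_scaleDr IHx IHy addrACA.
- rewrite !base_change_scale_pure mulrDl.
  exact: (@pureDl _ (restrict phi S^o)).
Qed.

HB.instance Definition _ := GRing.Zmodule_isLmodule.Build S (base_change phi N)
  base_change_scaleA base_change_scale1 base_change_scaleDr base_change_scaleDl.

End BaseChange.

Section BaseChangeMap.
Variables (R S : comPzRingType) (phi : {rmorphism R -> S}).
Variables (N N' : lmodType R) (g : {linear N -> N'}).

Definition base_change_map : base_change phi N -> base_change phi N' :=
  tensor_map (idfun : {linear restrict phi S^o -> restrict phi S^o}) g.

Lemma base_change_mapD x y :
  base_change_map (x + y) = base_change_map x + base_change_map y.
Proof. exact: tensor_mapD. Qed.

Lemma base_change_map0 : base_change_map 0 = 0.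
Proof. exact: tensor_map0. Qed.

Lemma base_change_map_pure (t : restrict phi S^o) n :
  base_change_map (pure t n) = pure t (g n).
Proof. exact: tensor_map_pure. Qed.

Lemma base_change_map_linear : linear base_change_map.
Proof.
move=> s x y; rewrite base_change_mapD; congr (_ + _).
elim/tensor_ind_pure: x => [|x z IHx IHz|t n].
- by rewrite scaler0 base_change_map0 scaler0.
- by rewrite scalerDr !base_change_mapD IHx IHz scalerDr.
- rewrite base_change_map_pure -[LHS]/(base_change_map (base_change_scale _ _)).
  rewrite base_change_scale_pure base_change_map_pure.
  by rewrite -[RHS]/(base_change_scale _ _) base_change_scale_pure.
Qed.

HB.instance Definition _ :=
  GRing.isLinear.Build S (base_change phi N) (base_change phi N') _
    base_change_map base_change_map_linear.

End BaseChangeMap.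

Arguments base_change_map {R S} phi {N N'} g.

Definition exact_at (R : pzRingType) (A B C : lmodType R)
    (f : {linear A -> B}) (g : {linear B -> C}) : Prop :=
  forall b : B, g b = 0 <-> exists a : A, f a = b.

Definition flat (R : comPzRingType) (M : lmodType R) : Prop :=
  forall (A B C : lmodType R) (f : {linear A -> B}) (g : {linear B -> C}),
    exact_at f g ->
    exact_at (tensor_map (idfun : {linear M -> M}) f)
             (tensor_map (idfun : {linear M -> M}) g).

Definition faithfully_flat (R : comPzRingType) (M : lmodType R) : Prop :=
  forall (A B C : lmodType R) (f : {linear A -> B}) (g : {linear B -> C}),
    (forall a, g (f a) = 0) ->
    (exact_at f g <->
     exact_at (tensor_map (idfun : {linear M -> M}) f)
              (tensor_map (idfun : {linear M -> M}) g)).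

Definition flat_hom (R S : comPzRingType) (phi : {rmorphism R -> S}) : Prop :=
  flat (restrict phi S^o).

Definition faithfully_flat_hom (R S : comPzRingType)
    (phi : {rmorphism R -> S}) : Prop :=
  faithfully_flat (restrict phi S^o).

Definition injective_module (R : pzRingType) (I : lmodType R) : Prop :=
  forall (A B : lmodType R) (f : {linear A -> B}) (g : {linear A -> I}),
    injective f -> exists h : {linear B -> I}, forall a, h (f a) = g a.

(* diff i is the differential F_(i+1) -> F_i. *)
Record complex (R : pzRingType) := Complex {
  obj :> int -> lmodType R;
  diff : forall i : int, {linear obj (i + 1) -> obj i};
  diff_diff : forall (i : int) (x : obj (i + 1 + 1)),
    diff i (diff (i + 1) x) = 0
}.

Definition acyclic (R : pzRingType) (F : complex R) : Prop :=
  forall i : int, exact_at (diff F (i + 1)) (diff F i).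

Section ComplexTensor.
Variables (R : comPzRingType).

Lemma tensor_complex_subproof (M : lmodType R) (F : complex R) (i : int)
    (x : tensor M (F (i + 1 + 1))) :
  tensor_map (idfun : {linear M -> M}) (diff F i)
    (tensor_map (idfun : {linear M -> M}) (diff F (i + 1)) x) = 0.
Proof.
elim/tensor_ind_pure: x => [|x y IHx IHy|m n].
- by rewrite !tensor_map0.
- by rewrite !tensor_mapD IHx IHy addr0.
- by rewrite !tensor_map_pure diff_diff -(scale0r (0 : F i)) pureZr scale0r.
Qed.

Definition tensor_complex (M : lmodType R) (F : complex R) : complex R :=
  @Complex R (fun i => tensor M (F i) : lmodType R)
    (fun i => tensor_map (idfun : {linear M -> M}) (diff F i))
    (@tensor_complex_subproof M F).

Variables (S : comPzRingType) (phi : {rmorphism R -> S}).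

Definition base_change_complex (F : complex R) : complex S :=
  @Complex S (fun i => base_change phi (F i) : lmodType S)
    (fun i => base_change_map phi (diff F i))
    (@tensor_complex_subproof (restrict phi S^o) F).

End ComplexTensor.

Definition flat_complex (R : comPzRingType) (F : complex R) : Prop :=
  forall i : int, flat (F i).

(* The flatness of the terms of F is part of the notion. *)
Definition F_totally_acyclic (R : comPzRingType) (F : complex R) : Prop :=
  [/\ flat_complex F,
      acyclic F &
      forall I : lmodType R,
        injective_module I -> acyclic (tensor_complex I F)].

(* Main.v *)
(* Over S, both flatness and the injective modules are compared with R through
   N (x)_S (S (x)_R A) = N (x)_R A. For (1), an injective S-module stays
   injective over R because S is flat. For (2), flatness and acyclicity descend
   by faithful flatness. If I is R-injective, then Hom_R(S, I) is S-injective,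
   and I is an R-direct summand of it: the map I -> S (x)_R I, i |-> 1 (x) i, is
   injective because S is faithfully flat, so it has a retraction r, and
   i |-> (s |-> r (s (x) i)) is a section of the evaluation at 1. Hence I (x) F
   is a retract of Hom_R(S, I) (x)_S (S (x)_R F). *)

Require Import Defs.
From HB Require Import structures.
From mathcomp Require Import all_boot all_algebra.
From mathcomp Require Import boolp.

Set Implicit Arguments.
Unset Strict Implicit.
Unset Printing Implicit Defensive.

Import GRing.Theory.
Local Open Scope ring_scope.

(** * Exactness under retracts, and injectivity as exactness *)

(** A cycle [b] goes to the cycle [iB b], which is a boundary there, and [pA] brings a preimage
    back. The comparison maps are plain functions because the two sequences may live over different
    rings. *)
Lemma exact_at_retract (R R' : pzRingType) (A B C : lmodType R)
    (A' B' C' : lmodType R') (f : {linear A -> B}) (g : {linear B -> C})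
    (f' : {linear A' -> B'}) (g' : {linear B' -> C'})
    (pA : A' -> A) (iB : B -> B') (pB : B' -> B) (iC : C -> C') :
    (forall a, g (f a) = 0) -> cancel iB pB ->
    (forall x, pB (f' x) = f (pA x)) -> (forall y, g' (iB y) = iC (g y)) ->
    iC 0 = 0 ->
  exact_at f' g' -> exact_at f g.
Proof.
move=> gf iK pf ig iC0 ex b; split=> [gb|[a <-]]; last exact: gf.
have /ex[a fa] : g' (iB b) = 0 by rewrite ig gb iC0.
by exists (pA a); rewrite -pf fa iK.
Qed.

(** Recasts injectivity as exactness, the form in which [flat] and [faithfully_flat] apply. *)
Lemma exact_at_null (R : pzRingType) (A B C : lmodType R)
    (f : {linear A -> B}) (g : {linear B -> C}) :
  (forall a, f a = 0) -> exact_at f g <-> injective g.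
Proof.
move=> f0; split=> [ex x y gxy|ginj b].
  apply/eqP; rewrite -subr_eq0; apply/eqP.
  by have /ex[a <-] : g (x - y) = 0 by rewrite linearB gxy subrr.
split=> [gb|[a <-]]; last by rewrite f0 linear0.
by exists 0; rewrite f0; apply: ginj; rewrite gb linear0.
Qed.

Definition linear_of (R : pzRingType) (U V : lmodType R) (f : U -> V)
  (fL : linear f) : {linear U -> V} :=
  HB.pack f (GRing.isLinear.Build R U V _ f fL).

(** * Functoriality and symmetry of the tensor product *)

Section TensorMaps.
Variables (R : comPzRingType).
Implicit Types (L M N P : lmodType R).

Lemma pure0r M N (m : M) : pure m (0 : N) = 0.
Proof. by rewrite -(scale0r (0 : N)) -pureZ scale0r pure0l. Qed.

Lemma eq_tensor_map M N M' N' (f f' : {linear M -> M'})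
    (g g' : {linear N -> N'}) :
  f =1 f' -> g =1 g' -> tensor_map f g =1 tensor_map f' g'.
Proof.
move=> ff gg; apply: tensor_ind_pure => [|x y IHx IHy|m n].
- by rewrite !tensor_map0.
- by rewrite !tensor_mapD IHx IHy.
- by rewrite !tensor_map_pure ff gg.
Qed.

Lemma tensor_map_id M N (f : {linear M -> M}) (g : {linear N -> N}) :
  f =1 id -> g =1 id -> tensor_map f g =1 id.
Proof.
move=> ff gg; apply: tensor_ind_pure => [|x y IHx IHy|m n].
- by rewrite !tensor_map0.
- by rewrite !tensor_mapD IHx IHy.
- by rewrite !tensor_map_pure ff gg.
Qed.

Lemma tensor_mapC M N M' N' (f : {linear M -> M'}) (g : {linear N -> N'})
    (x : tensor M N) :
  tensor_map f idfun (tensor_map idfun g x) =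
  tensor_map idfun g (tensor_map f idfun x).
Proof.
elim/tensor_ind_pure: x => [|x y IHx IHy|m n].
- by rewrite !tensor_map0.
- by rewrite !tensor_mapD IHx IHy.
- by rewrite !tensor_map_pure.
Qed.

Lemma tensor_mapK M M' N (f : {linear M -> M'}) (g : {linear M' -> M}) :
    cancel f g ->
  cancel (tensor_map f (idfun : {linear N -> N})) (tensor_map g idfun).
Proof.
move=> fK; apply: tensor_ind_pure => [|x y IHx IHy|m n].
- by rewrite !tensor_map0.
- by rewrite !tensor_mapD IHx IHy.
- by rewrite !tensor_map_pure fK.
Qed.

Lemma tensor_map_comp0 L M N P (f : {linear M -> N}) (g : {linear N -> P}) :
    (forall m, g (f m) = 0) ->
  forall x, tensor_map (idfun : {linear L -> L}) g
              (tensor_map (idfun : {linear L -> L}) f x) = 0.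
Proof.
move=> gf; apply: tensor_ind_pure => [|x y IHx IHy|l m].
- by rewrite !tensor_map0.
- by rewrite !tensor_mapD IHx IHy addr0.
- by rewrite !tensor_map_pure gf pure0r.
Qed.

Lemma tensor_map_null L M N (f : {linear M -> N}) :
    (forall m, f m = 0) ->
  forall x, tensor_map (idfun : {linear L -> L}) f x = 0.
Proof.
move=> f0; apply: tensor_ind_pure => [|x y IHx IHy|l m].
- by rewrite !tensor_map0.
- by rewrite !tensor_mapD IHx IHy addr0.
- by rewrite !tensor_map_pure f0 pure0r.
Qed.

Lemma flat_injective L M N (f : {linear M -> N}) :
    flat L -> injective f ->
  injective (tensor_map (idfun : {linear L -> L}) f).
Proof.
move=> Lf finj.
(* The zero endomorphism of [M] serves as the incoming arrow, in place of [0 -> M]. *)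
have n0 : forall m : M, (\0 : {linear M -> M}) m = 0 by [].
apply/(exact_at_null _ (tensor_map_null n0))/Lf.
exact/exact_at_null.
Qed.

Lemma faithfully_flat_injective L M N (f : {linear M -> N}) :
    faithfully_flat L ->
    injective (tensor_map (idfun : {linear L -> L}) f) -> injective f.
Proof.
move=> Lf finj.
have n0 : forall m : M, (\0 : {linear M -> M}) m = 0 by [].
apply/(exact_at_null _ n0)/Lf; first by move=> a; rewrite linear0.
exact/exact_at_null/finj/tensor_map_null.
Qed.

(** Reconciles two conventions: [flat] tensors on the left, whereas the comparison maps [to_bc] and
    [of_bc] below have [base_change] on the right. *)
Definition tensor_swap M N : tensor M N -> tensor N M :=
  tensor_lift (fun m n => pure n m).

Lemma tensor_swap_balanced M N : balanced (fun (m : M) (n : N) => pure n m).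
Proof.
by split=> *; [exact: pureDr|exact: pureDl|rewrite pureZ].
Qed.

Lemma tensor_swap_pure M N (m : M) (n : N) : tensor_swap (pure m n) = pure n m.
Proof. exact: tensor_lift_pure (@tensor_swap_balanced M N) _ _. Qed.

Lemma tensor_swapD M N : {morph @tensor_swap M N : x y / x + y}.
Proof. exact: tensor_liftD (@tensor_swap_balanced M N). Qed.

Lemma tensor_swap0 M N : tensor_swap (0 : tensor M N) = 0.
Proof. by rewrite -(pure0l _ 0) tensor_swap_pure pure0l. Qed.

Lemma tensor_swapK M N : cancel (@tensor_swap M N) (@tensor_swap N M).
Proof.
apply: tensor_ind_pure => [|x y IHx IHy|m n].
- by rewrite !tensor_swap0.
- by rewrite !tensor_swapD IHx IHy.
- by rewrite !tensor_swap_pure.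
Qed.

Lemma tensor_swap_map M N M' N' (f : {linear M -> M'}) (g : {linear N -> N'})
    (x : tensor M N) :
  tensor_swap (tensor_map f g x) = tensor_map g f (tensor_swap x).
Proof.
elim/tensor_ind_pure: x => [|x y IHx IHy|m n].
- by rewrite tensor_swap0 !tensor_map0 tensor_swap0.
- by rewrite tensor_swapD !tensor_mapD tensor_swapD IHx IHy.
- by rewrite !(tensor_map_pure, tensor_swap_pure).
Qed.

End TensorMaps.

(** * Restriction of scalars on morphisms *)

Section RestrictMap.
Variables (R S : comPzRingType) (phi : {rmorphism R -> S}).
Variables (M N : lmodType S) (f : {linear M -> N}).

Lemma restrict_map_linear :
  linear (f : restrict phi M -> restrict phi N).
Proof. by move=> a x y; exact: (linearP f (phi a) x y). Qed.

Definition restrict_map : {linear restrict phi M -> restrict phi N} :=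
  linear_of restrict_map_linear.

End RestrictMap.

Arguments restrict_map {R S} phi {M N} f.

(** * The isomorphism N (x)_R A = N (x)_S (S (x)_R A), and flatness of base change *)

Section TensorBaseChange.
Variables (R S : comPzRingType) (phi : {rmorphism R -> S}).
Implicit Types (N : lmodType S) (A : lmodType R).
Local Notation Sr := (restrict phi S^o).

(** Typed in [base_change] with [s : S], so that scalars are read in [S] rather than in [R]. *)
Definition bpure A (s : S) (a : A) : base_change phi A := pure (s : Sr) a.

Lemma bpureDl A s t (a : A) : bpure (s + t) a = bpure s a + bpure t a.
Proof. exact: (@pureDl R Sr A s t a). Qed.

Lemma bpureDr A s (a b : A) : bpure s (a + b) = bpure s a + bpure s b.
Proof. exact: (@pureDr R Sr A s a b). Qed.

Lemma bpureZl A s t (a : A) : bpure (s * t) a = s *: bpure t a.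
Proof. exact/esym/base_change_scale_pure. Qed.

Lemma bpureZr A r s (a : A) : bpure s (r *: a) = phi r *: bpure s a.
Proof. by rewrite -bpureZl; apply/esym/(@pureZ R Sr A r s a). Qed.

Lemma bpure_map A A' (g : {linear A -> A'}) s a :
  base_change_map phi g (bpure s a) = bpure s (g a).
Proof. exact: base_change_map_pure. Qed.

Lemma base_change_ind A (P : base_change phi A -> Prop) :
    P 0 -> (forall x y, P x -> P y -> P (x + y)) ->
    (forall s a, P (bpure s a)) ->
  forall x, P x.
Proof. by move=> P0 PD Pp; exact: (@tensor_ind_pure R Sr A P). Qed.

Definition to_bc N A : tensor (restrict phi N) A -> tensor N (base_change phi A)
  := tensor_lift (fun (n : restrict phi N) (a : A) => pure (n : N) (bpure 1 a)).

Lemma to_bc_balanced N A :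
  balanced (fun (n : restrict phi N) (a : A) => pure (n : N) (bpure 1 a)).
Proof.
split=> [m n a|n a b|r n a].
- exact: (@pureDl S N).
- by rewrite bpureDr pureDr.
- by rewrite bpureZr; exact: (@pureZ S N).
Qed.

Lemma to_bc_pure N A (n : restrict phi N) (a : A) :
  to_bc (pure n a) = pure (n : N) (bpure 1 a).
Proof. exact: tensor_lift_pure (@to_bc_balanced N A) _ _. Qed.

Lemma to_bcD N A : {morph @to_bc N A : x y / x + y}.
Proof. exact: tensor_liftD (@to_bc_balanced N A). Qed.

Lemma to_bc0 N A : @to_bc N A 0 = 0.
Proof. by apply: (addrI (to_bc 0)); rewrite -to_bcD !addr0. Qed.

(** The inverse of [to_bc] is lifted twice: first on S (x)_R A for fixed [n], giving [act], then
    over [S], giving [of_bc]. *)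
Definition act N A (n : N) : base_change phi A -> tensor (restrict phi N) A :=
  tensor_lift (fun (s : Sr) (a : A) => pure ((s : S) *: n : restrict phi N) a).

Lemma act_balanced N A (n : N) :
  balanced (fun (s : Sr) (a : A) => pure ((s : S) *: n : restrict phi N) a).
Proof.
split=> [s t a|s a b|r s a].
- by rewrite scalerDl; exact: (@pureDl R (restrict phi N)).
- exact: pureDr.
- by rewrite -pureZ -scalerA.
Qed.

Lemma act_pure N A (n : N) s (a : A) :
  act n (bpure s a) = pure (s *: n : restrict phi N) a.
Proof. exact: (tensor_lift_pure (@act_balanced N A n) (s : Sr) a). Qed.

Lemma actD N A (n : N) : {morph @act N A n : x y / x + y}.
Proof. exact: tensor_liftD (@act_balanced N A n). Qed.

Lemma act0 N A (n : N) : @act N A n 0 = 0.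
Proof. by apply: (addrI (act n 0)); rewrite -actD !addr0. Qed.

Definition of_bc N A : tensor N (base_change phi A) -> tensor (restrict phi N) A
  := tensor_lift (@act N A).

Lemma of_bc_balanced N A : balanced (@act N A).
Proof.
split=> [m n|n|s n]; last 1 first.
- elim/base_change_ind => [|x y IHx IHy|t a].
  + by rewrite scaler0 !act0.
  + by rewrite scalerDr !actD IHx IHy.
  + by rewrite -bpureZl !act_pure scalerA mulrC.
- elim/base_change_ind => [|x y IHx IHy|s a].
  + by rewrite !act0 addr0.
  + by rewrite !actD IHx IHy addrACA.
  + by rewrite !act_pure scalerDr; exact: (@pureDl R (restrict phi N)).
- exact: actD.
Qed.

Lemma of_bc_pure N A n s (a : A) :
  of_bc (pure (n : N) (bpure s a)) = pure (s *: n : restrict phi N) a.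
Proof.
by rewrite -act_pure; exact: tensor_lift_pure (@of_bc_balanced N A) _ _.
Qed.

Lemma of_bcD N A : {morph @of_bc N A : x y / x + y}.
Proof. exact: tensor_liftD (@of_bc_balanced N A). Qed.

Lemma of_bc0 N A : @of_bc N A 0 = 0.
Proof. by apply: (addrI (of_bc 0)); rewrite -of_bcD !addr0. Qed.

Lemma to_bcK N A : cancel (@to_bc N A) (@of_bc N A).
Proof.
apply: tensor_ind_pure => [|x y IHx IHy|n a].
- by rewrite to_bc0 of_bc0.
- by rewrite to_bcD of_bcD IHx IHy.
- by rewrite to_bc_pure of_bc_pure scale1r.
Qed.

Lemma tensor_bc_ind N A (P : tensor N (base_change phi A) -> Prop) :
    P 0 -> (forall x y, P x -> P y -> P (x + y)) ->
    (forall n s a, P (pure n (bpure s a))) ->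
  forall x, P x.
Proof.
move=> P0 PD Pp; elim/tensor_ind_pure => // n.
elim/base_change_ind => [|x y Px Py|s a] //; first by rewrite pure0r.
by rewrite pureDr; exact: PD.
Qed.

(** Here the balancing over [S] is what counts: s n (x) (1 (x) a) = n (x) (s (x) a). *)
Lemma of_bcK N A : cancel (@of_bc N A) (@to_bc N A).
Proof.
elim/tensor_bc_ind => [|x y IHx IHy|n s a].
- by rewrite of_bc0 to_bc0.
- by rewrite of_bcD to_bcD IHx IHy.
- by rewrite of_bc_pure to_bc_pure pureZ -bpureZl mulr1.
Qed.

Lemma to_bc_map N N' A A' (f : {linear N -> N'}) (g : {linear A -> A'})
    (x : tensor (restrict phi N) A) :
  to_bc (tensor_map (restrict_map phi f) g x) =
  tensor_map f (base_change_map phi g) (to_bc x).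
Proof.
elim/tensor_ind_pure: x => [|x y IHx IHy|n a].
- by rewrite to_bc0 !tensor_map0 to_bc0.
- by rewrite to_bcD !tensor_mapD to_bcD IHx IHy.
- by rewrite to_bc_pure !tensor_map_pure to_bc_pure /= bpure_map.
Qed.

Lemma of_bc_map N N' A A' (f : {linear N -> N'}) (g : {linear A -> A'})
    (x : tensor N (base_change phi A)) :
  of_bc (tensor_map f (base_change_map phi g) x) =
  tensor_map (restrict_map phi f) g (of_bc x).
Proof. by rewrite -[x in LHS]of_bcK -to_bc_map to_bcK. Qed.


Lemma of_bc_mapl N N' A (f : {linear N -> N'})
    (x : tensor N (base_change phi A)) :
  of_bc (tensor_map f idfun x) =
  tensor_map (restrict_map phi f) idfun (of_bc x).
Proof.
(* [idfun] on [base_change phi A] and [base_change_map phi idfun] are different terms that agree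
   pointwise. *)
rewrite -of_bc_map; congr of_bc; apply: eq_tensor_map => // y.
exact/esym/(@tensor_map_id R Sr A).
Qed.

Lemma of_bc_mapr N A A' (g : {linear A -> A'}) x :
  of_bc (tensor_map (idfun : {linear N -> N}) (base_change_map phi g) x) =
  tensor_map idfun g (of_bc x).
Proof. by rewrite of_bc_map; apply: eq_tensor_map. Qed.

Lemma to_bc_mapr N A A' (g : {linear A -> A'}) (x : tensor (restrict phi N) A) :
  to_bc (tensor_map idfun g x) =
  tensor_map (idfun : {linear N -> N}) (base_change_map phi g) (to_bc x).
Proof. by rewrite -[x in LHS]to_bcK -of_bc_mapr of_bcK. Qed.

(** Since (S (x)_R A) (x)_S X = A (x)_R X naturally in X, tensoring over [S] with the base change
    amounts to restricting to [R] and tensoring with the flat module [A]. *)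
Lemma flat_base_change A : flat A -> flat (base_change phi A).
Proof.
move=> Af X Y Z f g ex.
pose i W (x : tensor (base_change phi A) W) : tensor A (restrict phi W) :=
  tensor_swap (of_bc (tensor_swap x)).
pose p W (x : tensor A (restrict phi W)) : tensor (base_change phi A) W :=
  tensor_swap (to_bc (tensor_swap x)).
have iK W : cancel (@i W) (@p W).
  by move=> x; rewrite /i /p tensor_swapK of_bcK tensor_swapK.
have pK W : cancel (@p W) (@i W).
  by move=> x; rewrite /i /p tensor_swapK to_bcK tensor_swapK.
have i_map (V W : lmodType S) (h : {linear V -> W}) x :
    i W (tensor_map idfun h x) = tensor_map idfun (restrict_map phi h) (i V x).
  by rewrite /i tensor_swap_map of_bc_mapl tensor_swap_map.
(* [ex] is passed as exactness of the restricted sequence, whose underlying functions are the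
   same. *)
apply: (exact_at_retract (pA := @p X) (iB := @i Y) (pB := @p Y) (iC := @i Z)
         _ _ _ _ _ (Af _ _ _ (restrict_map phi f) (restrict_map phi g) ex)).
- by apply: tensor_map_comp0 => a; apply/ex; exists a.
- exact: iK.
- move=> x; apply: (can_inj (@iK Y)); rewrite pK i_map.
  by congr (tensor_map _ _ _); rewrite pK.
- by move=> y; exact/esym/i_map.
- by rewrite /i tensor_swap0 of_bc0 tensor_swap0.
Qed.

(** * Injective modules under restriction of scalars *)

Lemma base_change_act_balanced A (I : lmodType S)
    (g : {linear A -> restrict phi I}) :
  balanced (fun (s : Sr) (a : A) => (s : S) *: (g a : I)).
Proof.
split=> [s t a|s a b|r s a].
- exact: (@scalerDl S I).
- by rewrite linearD; exact: (@scalerDr S I).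
- rewrite linearZ; apply: etrans (esym (@scalerA S I _ _ _)).
  by rewrite mulrC.
Qed.

(** Adjunction: [g] extends [S]-linearly to [G] on S (x) A, flatness keeps S (x) f injective,
    injectivity over [S] extends [G] along it to [h], and [h] composed with b |-> 1 (x) b extends
    [g]. *)
Lemma injective_restrict (I : lmodType S) :
  flat_hom phi -> injective_module I -> injective_module (restrict phi I).
Proof.
move=> hphi Iinj A B f g finj.
have gB := base_change_act_balanced g.
pose G : base_change phi A -> I := @tensor_lift R Sr A _
   (fun (s : Sr) (a : A) => (s : S) *: (g a : I)).
have Gp s a : G (bpure s a) = s *: (g a : I).
  exact: (tensor_lift_pure gB (s : Sr) a).
have GD : {morph G : x y / x + y} by exact: tensor_liftD gB.
have G0 : G 0 = 0 by apply: (addrI (G 0)); rewrite -GD !addr0.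
have GL : linear G.
  move=> s x y; rewrite GD; congr (_ + _).
  elim/base_change_ind: x => [|u v IHu IHv|t a].
  - by rewrite scaler0 G0 scaler0.
  - by rewrite scalerDr !GD IHu IHv scalerDr.
  - by rewrite -bpureZl !Gp scalerA.
have finj' : injective (base_change_map phi f).
  exact: (flat_injective hphi finj).
have [h hP] := Iinj _ _ (base_change_map phi f) (linear_of GL) finj'.
have HL : linear (fun b => h (bpure 1 b) : restrict phi I).
  by move=> r x y; rewrite bpureDr bpureZr linearP.
exists (linear_of HL) => a /=.
by rewrite -bpure_map hP /= Gp scale1r.
Qed.

(** * Associativity S (x) (M (x) A) = (S (x) M) (x) A, and descent of flatness *)

Lemma pure_linearl (M A : lmodType R) (a : A) : linear (fun m : M => pure m a).
Proof. by move=> r x y; rewrite pureDl pureZl. Qed.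

Lemma bpure_linear (M : lmodType R) s :
  linear (fun m : M => bpure s m : restrict phi (base_change phi M)).
Proof. by move=> r x y; rewrite bpureDr bpureZr. Qed.

(** For fixed [s] this is - (x) A applied to m |-> s (x) m, so additivity on M (x) A is inherited
    from [tensor_map]. *)
Definition assoc (M A : lmodType R) :
    base_change phi (tensor M A) -> tensor (restrict phi (base_change phi M)) A
  := @tensor_lift R Sr (tensor M A) _
    (fun s => tensor_map (linear_of (@bpure_linear M s)) idfun).

Lemma assoc_balanced (M A : lmodType R) :
  balanced (fun (s : Sr) =>
    tensor_map (linear_of (@bpure_linear M s)) (idfun : {linear A -> A})).
Proof.
split=> [s t x|s x y|r s x]; last 1 first.
- elim/tensor_ind_pure: x => [|x y IHx IHy|m a].
  + by rewrite scaler0 !tensor_map0.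
  + by rewrite scalerDr !tensor_mapD IHx IHy.
  + rewrite -pureZl !tensor_map_pure /=; congr pure.
    by rewrite bpureZl bpureZr.
- elim/tensor_ind_pure: x => [|x y IHx IHy|m a].
  + by rewrite !tensor_map0 addr0.
  + by rewrite !tensor_mapD IHx IHy addrACA.
  + by rewrite !tensor_map_pure /= bpureDl pureDl.
- exact: tensor_mapD.
Qed.

Lemma assoc_pure (M A : lmodType R) s (m : M) (a : A) :
  assoc (bpure s (pure m a)) =
  pure (bpure s m : restrict phi (base_change phi M)) a.
Proof.
apply: etrans (tensor_lift_pure (@assoc_balanced M A) (s : Sr) _) _.
by rewrite tensor_map_pure.
Qed.

Lemma assocD (M A : lmodType R) : {morph @assoc M A : x y / x + y}.
Proof. exact: tensor_liftD (@assoc_balanced M A). Qed.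

Lemma assoc0 (M A : lmodType R) : @assoc M A 0 = 0.
Proof. by apply: (addrI (assoc 0)); rewrite -assocD !addr0. Qed.

Definition unassoc (M A : lmodType R) :
    tensor (restrict phi (base_change phi M)) A -> base_change phi (tensor M A)
  := tensor_lift (fun (x : restrict phi (base_change phi M)) (a : A) =>
       base_change_map phi (linear_of (@pure_linearl M A a)) x).

Lemma unassoc_balanced (M A : lmodType R) :
  balanced (fun (x : restrict phi (base_change phi M)) (a : A) =>
       base_change_map phi (linear_of (@pure_linearl M A a)) x).
Proof.
split=> [x y a|x a b|r x a].
- exact: base_change_mapD.
- elim/base_change_ind: x => [|x y IHx IHy|s m].
  + by rewrite !base_change_map0 addr0.
  + by rewrite !base_change_mapD IHx IHy addrACA.
  + by rewrite !bpure_map /= pureDr bpureDr.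
- elim/base_change_ind: x => [|x y IHx IHy|s m].
  + by rewrite scaler0 !base_change_map0.
  + by rewrite scalerDr !base_change_mapD IHx IHy.
  (* On [restrict] the scalar [r] acts as [phi r], which passes through the tensor to [m]. *)
  + rewrite [X in base_change_map _ _ X](_ : _ = bpure s (r *: m)).
      by rewrite !bpure_map /= pureZ.
    by rewrite bpureZr.
Qed.

Lemma unassoc_pure (M A : lmodType R) s (m : M) (a : A) :
  unassoc (pure (bpure s m : restrict phi (base_change phi M)) a) =
  bpure s (pure m a).
Proof.
by rewrite /unassoc (tensor_lift_pure (@unassoc_balanced M A)) bpure_map.
Qed.

Lemma unassocD (M A : lmodType R) : {morph @unassoc M A : x y / x + y}.
Proof. exact: tensor_liftD (@unassoc_balanced M A). Qed.

Lemma unassoc0 (M A : lmodType R) : @unassoc M A 0 = 0.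
Proof. by apply: (addrI (unassoc 0)); rewrite -unassocD !addr0. Qed.

Lemma base_change_tensor_ind (M A : lmodType R)
    (P : base_change phi (tensor M A) -> Prop) :
    P 0 -> (forall x y, P x -> P y -> P (x + y)) ->
    (forall s m a, P (bpure s (pure m a))) ->
  forall x, P x.
Proof.
move=> P0 PD Pp; elim/base_change_ind => // s.
elim/tensor_ind_pure => [|x y Px Py|m a] //.
  by rewrite -(scale0r 0) bpureZr rmorph0 scale0r.
by rewrite bpureDr; exact: PD.
Qed.

Lemma assocK (M A : lmodType R) : cancel (@assoc M A) (@unassoc M A).
Proof.
elim/base_change_tensor_ind => [|x y IHx IHy|s m a].
- by rewrite assoc0 unassoc0.
- by rewrite assocD unassocD IHx IHy.
- by rewrite assoc_pure unassoc_pure.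
Qed.

Lemma unassocK (M A : lmodType R) : cancel (@unassoc M A) (@assoc M A).
Proof.
apply: tensor_ind_pure => [|x y IHx IHy|x a].
- by rewrite unassoc0 assoc0.
- by rewrite unassocD assocD IHx IHy.
elim/base_change_ind: x => [|x y IHx IHy|s m].
- by rewrite pure0l unassoc0 assoc0.
- by rewrite pureDl unassocD assocD IHx IHy.
- by rewrite unassoc_pure assoc_pure.
Qed.

Lemma assoc_map (M A B : lmodType R) (f : {linear A -> B})
    (x : base_change phi (tensor M A)) :
  assoc (base_change_map phi (tensor_map (idfun : {linear M -> M}) f) x) =
  tensor_map idfun f (assoc x).
Proof.
elim/base_change_tensor_ind: x => [|x y IHx IHy|s m a].
- by rewrite base_change_map0 !assoc0 tensor_map0.
- by rewrite base_change_mapD !assocD IHx IHy tensor_mapD.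
- by rewrite bpure_map assoc_pure /= !tensor_map_pure assoc_pure.
Qed.

(** By S (x) (M (x) X) = (S (x) M) (x)_S (S (x) X), naturally in X, the base change of the sequence
    tensored with [M] is an exact sequence over [S] tensored with the flat module S (x) M. Faithful
    flatness then reflects exactness. *)
Lemma flat_descent (M : lmodType R) :
    flat_hom phi -> faithfully_flat_hom phi -> flat (base_change phi M) ->
  flat M.
Proof.
move=> hphi hff Mf A B C f g ex.
have gf : forall a, g (f a) = 0 by move=> a; apply/ex; exists a.
have tgf := tensor_map_comp0 (L := M) gf.
apply/(hff _ _ _ _ _ tgf).
have ex' : exact_at (base_change_map phi f) (base_change_map phi g).
  exact: hphi ex.
(* [i] composes associativity with the isomorphism [to_bc]; [p] is its inverse. *)
pose i X (x : base_change phi (tensor M X)) := to_bc (assoc x).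
pose p X (x : tensor (base_change phi M) (base_change phi X)) :=
  unassoc (of_bc x).
have iK X : cancel (@i X) (@p X).
  by move=> x; rewrite /i /p to_bcK assocK.
have pK X : cancel (@p X) (@i X).
  by move=> x; rewrite /i /p unassocK of_bcK.
have p_map (X Y : lmodType R) (h : {linear X -> Y}) x :
    p Y (tensor_map idfun (base_change_map phi h) x) =
    base_change_map phi (tensor_map idfun h) (p X x).
  rewrite /p of_bc_mapr -[of_bc x in LHS]unassocK -assoc_map.
  by rewrite assocK.
(* Reads the maps as [S]-linear ones with the same underlying functions. *)
change (exact_at
  (base_change_map phi (tensor_map (idfun : {linear M -> M}) f))
  (base_change_map phi (tensor_map (idfun : {linear M -> M}) g))).
apply: (exact_at_retract (pA := @p A) (iB := @i B) (pB := @p B) (iC := @i C)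
         _ _ _ _ _ (Mf _ _ _ _ _ ex')).
- exact: tensor_map_comp0.
- exact: iK.
- exact: p_map.
- move=> y; apply: (can_inj (@pK C)); rewrite p_map.
  by rewrite (iK B y) (iK C).
- by rewrite /i assoc0 to_bc0.
Qed.

(** * Injectivity of m |-> 1 (x) m under faithful flatness *)

(** Makes the multiplication S (x)_R N -> N well defined. *)
Lemma scale_balanced (N : lmodType S) :
  balanced (fun (s : Sr) (x : restrict phi N) => (s : S) *: (x : N)).
Proof.
split=> [s t x|s x y|r s x].
- exact: (@scalerDl S N).
- exact: (@scalerDr S N).
- apply: etrans (esym (@scalerA S N _ _ _)) _.
  by rewrite (@scalerA S N) mulrC -scalerA.
Qed.

(** Faithful flatness lets injectivity be checked after S (x) -, where the multiplication S (x) (S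
    (x) M) -> S (x) M is a left inverse. *)
Lemma bpure1_injective (M : lmodType R) :
  faithfully_flat_hom phi -> injective (@bpure M 1).
Proof.
move=> hff.
apply: (faithfully_flat_injective (f := linear_of (@bpure_linear M 1)) hff).
have mB := scale_balanced (base_change phi M).
pose mu := @tensor_lift R Sr (restrict phi (base_change phi M)) _
  (fun (s : Sr) (x : restrict phi (base_change phi M)) =>
     (s : S) *: (x : base_change phi M)).
have muD : {morph mu : x y / x + y} by exact: tensor_liftD mB.
have mu0 : mu 0 = 0 by apply: (addrI (mu 0)); rewrite -muD !addr0.
have muE (s : Sr) (x : restrict phi (base_change phi M)) :
    mu (pure s x) = (s : S) *: (x : base_change phi M).
  exact: (tensor_lift_pure mB).
apply: (can_inj (g := mu)); apply: tensor_ind_pure => [|x y IHx IHy|s m].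
- by rewrite tensor_map0 mu0.
- by rewrite tensor_mapD muD IHx IHy.
- by rewrite tensor_map_pure muE -bpureZl mulr1.
Qed.

End TensorBaseChange.

(* Hom_R(S, I), coinduced along phi. *)
Record coext (R S : comPzRingType) (phi : {rmorphism R -> S})
    (I : lmodType R) := Coext {
  coext_fun :> S -> I;
  coext_linear : forall a s t,
    coext_fun (phi a * s + t) = a *: coext_fun s + coext_fun t
}.

(** * The coinduced module, its injectivity, and its retraction onto [I] *)

Section Coext.
Variables (R S : comPzRingType) (phi : {rmorphism R -> S}) (I : lmodType R).
Local Notation coext := (coext phi I).

HB.instance Definition _ := gen_eqMixin coext.
HB.instance Definition _ := gen_choiceMixin coext.

Lemma coextP (h k : coext) : h =1 k -> h = k.
Proof.
case: h k => [h hL] [k kL] /= /funext hk; case: _ / hk kL => kL.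
by congr Coext; exact: Prop_irrelevance.
Qed.

Lemma coextD (h : coext) s t : h (s + t) = h s + h t.
Proof. by rewrite -[s in LHS]mul1r -(rmorph1 phi) coext_linear scale1r. Qed.

Lemma coextZ (h : coext) a s : h (phi a * s) = a *: h s.
Proof.
have h0 : h 0 = 0 by apply: (addrI (h 0)); rewrite -coextD !addr0.
by rewrite -[phi a * s]addr0 coext_linear h0 addr0.
Qed.

Lemma coext_zero_subproof a (s t : S) : 0 = a *: 0 + 0 :> I.
Proof. by rewrite scaler0 addr0. Qed.

Definition coext_zero : coext := Coext coext_zero_subproof.

Lemma coext_opp_subproof (h : coext) a s t :
  - h (phi a * s + t) = a *: (- h s) - h t.
Proof. by rewrite coext_linear opprD scalerN. Qed.

Definition coext_opp (h : coext) : coext := Coext (coext_opp_subproof h).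

Lemma coext_add_subproof (h k : coext) a s t :
  h (phi a * s + t) + k (phi a * s + t) = a *: (h s + k s) + (h t + k t).
Proof. by rewrite !coext_linear scalerDr addrACA. Qed.

Definition coext_add (h k : coext) : coext := Coext (coext_add_subproof h k).

Lemma coext_scale_subproof s (h : coext) a t u :
  h (s * (phi a * t + u)) = a *: h (s * t) + h (s * u).
Proof. by rewrite mulrDr mulrCA coext_linear. Qed.

Definition coext_scale s (h : coext) : coext :=
  Coext (coext_scale_subproof s h).

Lemma coext_addA : associative coext_add.
Proof. by move=> h k l; apply: coextP => s /=; rewrite addrA. Qed.

Lemma coext_addC : commutative coext_add.
Proof. by move=> h k; apply: coextP => s /=; rewrite addrC. Qed.

Lemma coext_add0 : left_id coext_zero coext_add.
Proof. by move=> h; apply: coextP => s /=; rewrite add0r. Qed.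

Lemma coext_addN : left_inverse coext_zero coext_opp coext_add.
Proof. by move=> h; apply: coextP => s /=; rewrite addNr. Qed.

HB.instance Definition _ :=
  GRing.isZmodule.Build coext coext_addA coext_addC coext_add0 coext_addN.

(** Precomposition reverses the order of [s] and [t]; commutativity of [S] restores it. *)
Lemma coext_scaleA s t h :
  coext_scale s (coext_scale t h) = coext_scale (s * t) h.
Proof. by apply: coextP => u /=; rewrite mulrA [t * s]mulrC. Qed.

Lemma coext_scale1 : left_id 1 coext_scale.
Proof. by move=> h; apply: coextP => u /=; rewrite mul1r. Qed.

Lemma coext_scaleDr : right_distributive coext_scale +%R.
Proof. by move=> s h k; apply: coextP. Qed.

Lemma coext_scaleDl h : {morph coext_scale^~ h : s t / s + t}.
Proof. by move=> s t; apply: coextP => u /=; rewrite mulrDl coextD. Qed.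

HB.instance Definition _ := GRing.Zmodule_isLmodule.Build S coext
  coext_scaleA coext_scale1 coext_scaleDr coext_scaleDl.

Lemma coext_addE (h k : coext) s : (h + k) s = h s + k s.
Proof. by []. Qed.

Lemma coext_scaleE s (h : coext) t : (s *: h) t = h (s * t).
Proof. by []. Qed.

(** The adjunction Hom_S(A, Hom_R(S, I)) = Hom_R(A, I) reduces the problem to extending over [R] the
    map [g] followed by evaluation at 1. *)
Lemma injective_coext : injective_module I -> injective_module coext.
Proof.
move=> Iinj A B f g finj.
have eL : linear (fun a : restrict phi A => g a 1).
  move=> r x y; apply: etrans (congr1 (fun h : coext => h 1)
    (linearP g (phi r) x y)) _.
  by rewrite coext_addE coext_scaleE coextZ.
have [h hP] := Iinj _ _ (restrict_map phi f) (linear_of eL) finj.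
(* The extension [h] is turned back into b |-> (s |-> h (s b)); this is the linearity in [s] that
   [Coext] asks for. *)
have HL b a s t : h ((phi a * s + t) *: (b : B) : restrict phi B) =
    a *: h (s *: b : restrict phi B) + h (t *: b : restrict phi B).
  by rewrite scalerDl -scalerA; exact: (linearP h).
have kL : linear (fun b : B => Coext (HL b)).
  move=> s x y; apply: coextP => t; rewrite coext_addE coext_scaleE /=.
  by rewrite scalerDr scalerA mulrC; exact: (linearD h).
exists (linear_of kL) => a; apply: coextP => s /=.
(* The chain is h (s f(a)) = h (f (s a)) = g (s a) 1 = g a s. *)
rewrite -linearZ; apply: etrans (hP _) _ => /=.
by rewrite linearZ /= mulr1.
Qed.

Lemma coext_retract :
    faithfully_flat_hom phi -> injective_module I ->
  exists (u : {linear I -> restrict phi coext})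
         (e : {linear restrict phi coext -> I}), cancel u e.
Proof.
move=> hff Iinj.
(* Extending the identity of [I] along i |-> 1 (x) i gives the retraction [r]. *)
have [r rP] := Iinj _ _ (linear_of (@bpure_linear R S phi I 1))
  (idfun : {linear I -> I}) (bpure1_injective hff).
have hL (i : I) a s t : r (bpure phi (phi a * s + t) i) =
    a *: r (bpure phi s i) + r (bpure phi t i).
  by rewrite bpureDl bpureZl; exact: (linearP r).
have uL : linear (fun i => Coext (hL i) : restrict phi coext).
  move=> a i j; apply: coextP => s.
  apply: etrans (esym (coext_addE _ _ _)); rewrite coext_scaleE /=.
  (* The action of [a] on the image of [i] replaces [s] by [phi a * s], and the same scalar appears
     on the other side by moving [a] across the tensor. *)
  rewrite bpureDr bpureZr -bpureZl; exact: (linearD r).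
have eL : linear (fun h : restrict phi coext => (h : coext) 1).
  move=> a h k; apply: etrans (coext_addE _ _ _) _.
  by rewrite coext_scaleE coextZ.
by exists (linear_of uL), (linear_of eL) => i; exact: rP.
Qed.

End Coext.

(** * Acyclicity under base change *)

Section Complexes.
Variables (R S : comPzRingType) (phi : {rmorphism R -> S}) (F : complex R).

(** The isomorphisms [to_bc] and [of_bc] are natural, hence commute with the differentials, and
    transport exactness degree by degree. *)
Lemma acyclic_to_bc (N : lmodType S) :
  acyclic (tensor_complex (restrict phi N) F) ->
  acyclic (tensor_complex N (base_change_complex phi F)).
Proof.
move=> ac i.
apply: (exact_at_retract
  (pA := @to_bc R S phi N _) (iB := @of_bc R S phi N _)
  (pB := @to_bc R S phi N _) (iC := @of_bc R S phi N _) _ _ _ _ _ (ac i)).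
- exact: (diff_diff (c := tensor_complex N (base_change_complex phi F))).
- exact: of_bcK.
- exact: to_bc_mapr.
- by move=> y; exact/esym/of_bc_mapr.
- exact: of_bc0.
Qed.

(** Tensoring [u] and [e] with [F] and composing with the natural isomorphism makes I (x) F a
    retract of N (x)_S (S (x) F). *)
Lemma acyclic_of_bc (I : lmodType R) (N : lmodType S)
    (u : {linear I -> restrict phi N}) (e : {linear restrict phi N -> I}) :
    cancel u e ->
    acyclic (tensor_complex N (base_change_complex phi F)) ->
  acyclic (tensor_complex I F).
Proof.
move=> uK ac i.
pose j (A : lmodType R) (x : tensor I A) : tensor N (base_change phi A) :=
  to_bc (tensor_map u idfun x).
pose p (A : lmodType R) (x : tensor N (base_change phi A)) : tensor I A :=
  tensor_map e idfun (of_bc x).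
apply: (exact_at_retract (pA := @p _) (iB := @j _) (pB := @p _) (iC := @j _)
  _ _ _ _ _ (ac i)).
- exact: (diff_diff (c := tensor_complex I F)).
- by move=> x; rewrite /p /j to_bcK tensor_mapK.
- by move=> x; rewrite /p of_bc_mapr tensor_mapC.
- by move=> y; rewrite /j tensor_mapC to_bc_mapr.
- by rewrite /j tensor_map0 to_bc0.
Qed.

End Complexes.

Theorem proposition2p7 (R S : comPzRingType) (phi : {rmorphism R -> S})
    (hphi : flat_hom phi) :
  (forall F : complex R,
      F_totally_acyclic F -> F_totally_acyclic (base_change_complex phi F)) /\
  (faithfully_flat_hom phi ->
    forall F : complex R,
      F_totally_acyclic (base_change_complex phi F) -> F_totally_acyclic F).
Proof.
split=> [F [Ff Fac Finj]|hff F [Ff Fac Finj]]; split.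
- by move=> i; exact/flat_base_change/Ff.
(* As functions, the differentials of the base change are S (x)_R - applied to those of [F], so
   flatness gives exactness directly. *)
- by move=> i; exact: (hphi _ _ _ _ _ (Fac i)).
- by move=> I Iinj; exact/acyclic_to_bc/Finj/injective_restrict.
- by move=> i; exact: (flat_descent hphi hff (Ff i)).
(* [diff_diff] supplies the zero composite under which [faithfully_flat] reflects exactness. *)
- by move=> i; apply/(hff _ _ _ _ _ (@diff_diff _ F i)); exact: Fac.
(* The hypothesis over [S] is used for the injective module [coext phi I], of which [I] is a retract
   over [R]. *)
- move=> I Iinj; have [u [e uK]] := coext_retract hff Iinj.
  exact/(acyclic_of_bc uK)/Finj/injective_coext.
Qed.
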